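(* Let $C\subset\mathbb{R}^d$ be a bounded measurable set such that $g$ is $C^2$ in a neighborhood of $C$, and suppose that for all $x\in S:=C^c$ the Green kernel equation $$\int_C G_r(x,y)\,(r-\mathcal L)g(y)\,dy=0$$ holds true. Then the Martin kernel equation $$\int_C e^{a\cdot y}\,(r-\mathcal L)g(y)\,dy=0\quad\text{for all }a\in B_{2r}$$ holds as well.
   Context: $r>0$ is fixed, $g\colon\mathbb{R}^d\to[0,\infty)$ is a continuous function, and the underlying process is the standard $d$-dimensional Wiener process, with infinitesimal generator $\mathcal L=\tfrac12\Delta$, so $(r-\mathcal L)g=rg-\tfrac12\Delta g$. The Green kernel is $$G_r(x,y)=\int_0^\infty e^{-rt}(2\pi t)^{-d/2}\exp\Big(-\frac{\|x-y\|^2}{2t}\Big)dt .$$ $B_{2r}:=\{a\in\mathbb{R}^d:\|a\|^2=2r\}$, $\|\cdot\|$ is the Euclidean norm, $a\cdot y$ is the scalar product, and $C^c=\mathbb{R}^d\setminus C$. Integrals are absolutely convergent Lebesgue integrals. *)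

(* Defs.v *)
From HB Require Import structures.
From mathcomp Require Import all_boot all_order all_algebra.
From mathcomp Require Import all_classical all_reals all_analysis.

Set Implicit Arguments.
Unset Strict Implicit.
Unset Printing Implicit Defensive.

Import Order.TTheory GRing.Theory Num.Theory.
Import numFieldNormedType.Exports.

Local Open Scope classical_set_scope.
Local Open Scope ring_scope.

(* R^d is 'rV[R]_d with the topology of the library. The sigma-algebra generated
   by the coordinates, installed here, is the Borel one. *)

Definition rV_display : measure_display.
Proof. exact: default_measure_display. Qed.

Section borel_rV.
Context {R : realType} (d : nat).

Definition rV_coord (i : 'I_d) (v : 'rV[R]_d) : R := v ord0 i.

Let rV_set0 : g_sigma_preimage rV_coord set0.
Proof. exact: sigma_algebra0. Qed.

Let rV_setC A : g_sigma_preimage rV_coord A -> g_sigma_preimage rV_coord (~` A).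
Proof. exact: sigma_algebraC. Qed.

Let rV_bigcup (F : (set 'rV[R]_d)^nat) :
  (forall i, g_sigma_preimage rV_coord (F i)) ->
  g_sigma_preimage rV_coord (\bigcup_i (F i)).
Proof. exact: sigma_algebra_bigcup. Qed.

HB.instance Definition _ := @isMeasurable.Build rV_display
  'rV[R]_d (g_sigma_preimage rV_coord) rV_set0 rV_setC rV_bigcup.

Lemma measurable_rV_coord (i : 'I_d) : measurable_fun [set: 'rV[R]_d] (rV_coord i).
Proof.
move=> _ Y mY; rewrite setTI; apply: sub_sigma_algebra => /=.
rewrite -bigcup_seq/=; exists i => /=; first by rewrite mem_index_enum.
by exists Y => //; rewrite setTI.
Qed.

End borel_rV.

Lemma measurable_fun_rV {R : realType} d0 (T : measurableType d0) d
    (f : T -> 'rV[R]_d) :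
  (forall i, measurable_fun [set: T] (fun x => f x ord0 i)) ->
  measurable_fun [set: T] f.
Proof.
move=> mf; have {}mf : g_sigma_preimage (fun i => @rV_coord R d i \o f) `<=` measurable.
  apply: smallest_sub; first exact: sigma_algebra_measurable.
  case: d => [|d] in f mf *; first by rewrite big_ord0.
  rewrite -bigcup_mkord_ord; apply: bigcup_sub => i Ii.
  by move=> A [B mB <-]; exact: mf.
move=> _ A mA; apply: mf; rewrite g_sigma_preimage_comp.
by exists A.
Qed.

Section lebesgue_rV.
Context {R : realType}.

Definition cons_rV d (p : R * 'rV[R]_d) : 'rV[R]_d.+1 :=
  row_mx (const_mx p.1 : 'rV[R]_1) p.2.

Lemma cons_rV0 d (p : R * 'rV[R]_d) : cons_rV p ord0 ord0 = p.1.
Proof.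
have -> : ord0 = lshift d (ord0 : 'I_1) :> 'I_d.+1 by exact/val_inj.
by rewrite [LHS]row_mxEl mxE.
Qed.

Lemma cons_rVS d (p : R * 'rV[R]_d) (i : 'I_d) :
  cons_rV p ord0 (lift ord0 i) = p.2 ord0 i.
Proof.
have -> : lift ord0 i = rshift 1 i by exact/val_inj.
by rewrite [LHS]row_mxEr.
Qed.

Lemma measurable_cons_rV d : measurable_fun [set: R * 'rV[R]_d] (@cons_rV d).
Proof.
apply: measurable_fun_rV => i.
have [j ->|->] := unliftP ord0 i.
  under eq_fun do rewrite cons_rVS.
  apply: (measurableT_comp (@measurable_rV_coord R d j)).
  exact: measurable_snd.
by under eq_fun do rewrite cons_rV0; exact: measurable_fst.
Qed.

Lemma measurable_behead_rV d : measurable_fun [set: 'rV[R]_d.+1]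
  (fun v => \row_(i < d) v ord0 (lift ord0 i)).
Proof.
apply: measurable_fun_rV => i.
by under eq_fun do rewrite mxE; exact: measurable_rV_coord.
Qed.

Section cons.
Variables (d : nat) (m : {sigma_finite_measure set 'rV[R]_d -> \bar R}).

Definition lebesgue_cons : set 'rV[R]_d.+1 -> \bar R :=
  pushforward (lebesgue_measure \x m)%E (@cons_rV d).

Let lebesgue_cons0 : lebesgue_cons set0 = 0%E.
Proof. by rewrite /lebesgue_cons /pushforward preimage_set0 measure0. Qed.

Let lebesgue_cons_ge0 A : (0 <= lebesgue_cons A)%E.
Proof. by rewrite /lebesgue_cons /pushforward. Qed.

Let lebesgue_cons_sigma_additive : semi_sigma_additive lebesgue_cons.
Proof.
move=> F mF tF mUF; rewrite /lebesgue_cons /pushforward preimage_bigcup.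
apply: measure_semi_sigma_additive.
- by move=> n; rewrite -[X in measurable X]setTI; exact: measurable_cons_rV.
- apply/trivIsetP => /= i j _ _ ij; rewrite -preimage_setI.
  by move/trivIsetP : tF => /(_ _ _ _ _ ij) ->//; rewrite preimage_set0.
- by rewrite -preimage_bigcup -[X in measurable X]setTI; exact: measurable_cons_rV.
Qed.

HB.instance Definition _ := isMeasure.Build _ _ _ lebesgue_cons
  lebesgue_cons0 lebesgue_cons_ge0 lebesgue_cons_sigma_additive.

Lemma lebesgue_consX (A : set R) (B : set 'rV[R]_d) :
  measurable A -> measurable B ->
  lebesgue_cons [set v | A (v ord0 ord0) /\ B (\row_i v ord0 (lift ord0 i))] =
  (lebesgue_measure A * m B)%E.
Proof.
move=> mA mB; rewrite /lebesgue_cons /pushforward -product_measure1E//.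
congr (_ _); apply/seteqP; split => -[x v] /=; rewrite cons_rV0;
  (have -> : \row_i cons_rV (x, v) ord0 (lift ord0 i) = v
     by apply/rowP => i; rewrite mxE cons_rVS) => //.
Qed.

Let lebesgue_cons_sigma_finite : sigma_finite setT lebesgue_cons.
Proof.
have /sigma_finiteP[F [TF ndF Foo]] := sigma_finiteT (@lebesgue_measure R).
have /sigma_finiteP[G [TG ndG Goo]] := sigma_finiteT m.
exists (fun n => [set v : 'rV[R]_d.+1 | F n (v ord0 ord0) /\
                         G n (\row_i v ord0 (lift ord0 i))]).
  apply/seteqP; split => // v _.
  have /= [n _ Fn] : (\bigcup_i F i) (v ord0 ord0) by rewrite -TF.
  have /= [k _ Gk] : (\bigcup_i G i) (\row_i v ord0 (lift ord0 i)) by rewrite -TG.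
  exists (maxn n k) => //; split.
  - by move: Fn; exact/subsetPset/ndF/leq_maxl.
  - by move: Gk; exact/subsetPset/ndG/leq_maxr.
move=> n; have [mF Fn] := Foo n; have [mG Gn] := Goo n; split; last first.
  by rewrite lebesgue_consX// lte_mul_pinfty// ge0_fin_numE.
apply: measurableI.
  by rewrite -[X in measurable X]setTI; exact: measurable_rV_coord.
rewrite -[X in measurable X]setTI.
exact: measurable_behead_rV.
Qed.

HB.instance Definition _ := Measure_isSigmaFinite.Build _ _ _ lebesgue_cons
  lebesgue_cons_sigma_finite.

End cons.

Let dirac_sigma_finite :
  sigma_finite [set: 'rV[R]_0] (\d_(0 : 'rV[R]_0) : set 'rV[R]_0 -> \bar R).
Proof.
exists (fun=> setT) => [|n]; first by rewrite bigcup_const.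
by split => //; rewrite diracT ltry.
Qed.

Definition dirac_rV0 : set 'rV[R]_0 -> \bar R := \d_(0 : 'rV[R]_0).

HB.instance Definition _ := Measure.on dirac_rV0.

HB.instance Definition _ := Measure_isSigmaFinite.Build _ _ _ dirac_rV0
  dirac_sigma_finite.

(* Lebesgue measure on the Borel sets, by recursion along R^(d+1) = R x R^d. *)
Fixpoint borel_lebesgue d : {sigma_finite_measure set 'rV[R]_d -> \bar R} :=
  match d with
  | 0 => dirac_rV0
  | d'.+1 => lebesgue_cons (borel_lebesgue d')
  end.

Lemma borel_lebesgue_box d (A : 'I_d -> set R) :
  (forall i, measurable (A i)) ->
  borel_lebesgue d [set v | forall i, A i (v ord0 i)] =
  (\prod_(i < d) lebesgue_measure (A i))%E.
Proof.
elim: d A => [A _|d IH A mA].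
  by rewrite big_ord0 /= /dirac_rV0 diracE mem_set// => -[].
rewrite big_ord_recl -IH// -lebesgue_consX//=.
  congr (lebesgue_cons _ _); apply/seteqP; split => v /= Av.
    by split => // i; rewrite mxE.
  by case: Av => A0 AS i; have [j ->|->//] := unliftP ord0 i; have := AS j; rewrite mxE.
rewrite [X in measurable X](_ : _ = \bigcap_i (rV_coord i @^-1` A (lift ord0 i))).
  apply: fin_bigcap_measurable => [|i _]; first exact: finite_finset.
  by rewrite -[X in measurable X]setTI; exact: measurable_rV_coord.
by apply/seteqP; split => v /= Av i; [move=> _; exact: Av|exact: (Av i)].
Qed.

End lebesgue_rV.

(* The completion of [borel_lebesgue]: integrals are taken with respect to this
   measure, so that sets and integrands need only be Lebesgue-measurable. *)
Definition lebesgue_rV (R : realType) (d : nat) :=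
  @completed_measure_extension _ _ _ (@borel_lebesgue R d).

HB.instance Definition _ (R : realType) (d : nat) := Measure.on (@lebesgue_rV R d).

Definition lebesgue_measurable (R : realType) (d : nat) : set (set 'rV[R]_d) :=
  ((@borel_lebesgue R d)^*)%mu.-cara.-measurable.

Lemma measurable_lebesgue_measurable (R : realType) (d : nat) (A : set 'rV[R]_d) :
  measurable A -> lebesgue_measurable A.
Proof. by move=> mA; apply: sub_caratheodory; exact: sub_sigma_algebra. Qed.

Lemma lebesgue_rVE (R : realType) (d : nat) (A : set 'rV[R]_d) :
  measurable A -> lebesgue_rV A = borel_lebesgue d A.
Proof. exact: measurable_mu_extE. Qed.

Section euclidean.
Context {R : realType} {d : nat}.
Implicit Types (a x y : 'rV[R]_d) (g : 'rV[R]_d -> R) (r : R).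

Definition dotp x y : R := \sum_(i < d) x ord0 i * y ord0 i.

(* The library's norm on 'rV[R]_d is the sup norm, hence a separate definition. *)
Definition enorm x : R := Num.sqrt (dotp x x).

(* [delta_mx ord0 i] is the i-th vector of the standard basis. *)
Definition partial (i : 'I_d) g : 'rV[R]_d -> R := 'D_(delta_mx ord0 i) g.

(* Meant for open U. *)
Definition C2_on (U : set 'rV[R]_d) g : Prop :=
  forall x, U x ->
  [/\ {for x, continuous g},
      forall i, derivable g x (delta_mx ord0 i) /\
        {for x, continuous (partial i g)} &
      forall i j, derivable (partial i g) x (delta_mx ord0 j) /\
        {for x, continuous (partial j (partial i g))}].

Definition laplacian g x : R := \sum_(i < d) partial i (partial i g) x.

Definition wiener_generator g x : R := 2^-1 * laplacian g x.

Definition resolvent_op r g x : R := r * g x - wiener_generator g x.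

(* Extended-real valued, since green r x x = +oo when d >= 2. *)
Definition green r x y : \bar R :=
  (\int[lebesgue_measure]_(t in `]0%R, +oo[)
     (expR (- (r * t)) * (2 * pi * t) `^ (- (d%:R / 2)) *
      expR (- (enorm (x - y) ^+ 2 / (2 * t))))%:E)%E.

Definition B2 r : set 'rV[R]_d := [set a | enorm a ^+ 2 = 2 * r].

End euclidean.

(* Main.v *)
(** With x = l a and |a|^2 = 2 r one has |x - y|^2 = 2 r l^2 - 2 l (a.y) + |y|^2,
    so G_r(x, y) integrates exp((l (a.y) - |y|^2 / 2) / t) against a weight
    proportional to t^(-d/2) exp(-r t - r l^2 / t).  As l -> +oo this weight
    concentrates around t = l, where the exponential is close to exp(a.y);
    hence G_r(l a, y) / G_r(l a, 0) tends to exp(a.y) uniformly for y in the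
    bounded set C.  The points l a leave C, so the Green kernel equation can be
    divided by G_r(l a, 0) and passed to the limit by dominated convergence.
    The quotient is bounded, and bounded away from 0 for one suitable l, so the
    integrand at that l dominates all the others; no integrability of
    (r - L) g on C has to be known beforehand. *)

Require Import Defs.
From mathcomp Require Import all_boot all_order all_algebra.
From mathcomp Require Import all_classical all_reals all_analysis.
From mathcomp Require Import measurable_realfun ring lra.
Set Implicit Arguments.
Unset Strict Implicit.
Unset Printing Implicit Defensive.

Import Order.TTheory GRing.Theory Num.Theory.
Import numFieldNormedType.Exports.
Local Open Scope classical_set_scope.
Local Open Scope ring_scope.

(** * Elementary estimates for exponentials, powers and the phase *)

(** Factoring out [expR b] leaves [|expR h - 1|], which [1 + h <= expR h] and
    [expR h <= 1 / (1 - h)] bound by [2 * |h|] for such [h]. *)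
Lemma normr_expRB_le (R : realType) (b h : R) :
  `|h| <= 2^-1 -> `|expR (b + h) - expR b| <= 2 * `|h| * expR b.
Proof.
move=> h2; rewrite expRD -[X in _ - X]mulr1 -mulrBr normrM ger0_norm ?expR_ge0//.
rewrite mulrC ler_wpM2r ?expR_ge0//.
have e1 := expR_ge1Dx h; have e2 := expR_ge1Dx (- h).
have e3 := expRxMexpNx_1 h; have e4 := expR_gt0 h; have e5 := expR_gt0 (- h).
have [h0|h0] := ger0P h; have [k0|k0] := ger0P (expR h - 1);
  rewrite ?(ger0_norm h0) ?(ltr0_norm h0) in h2 *; nra.
Qed.

(** Apply [ln u <= u] to [u = l * z]: [x * ln z] is at most [x * l * z - x * ln l], and
    [x * l <= k]. The denominator [x + 1] of [l] covers [x = 0]. *)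
Lemma powR_le_expR (R : realType) (x k : R) : 0 <= x -> 0 < k ->
  exists2 B, 0 < B & forall z, 0 < z -> z `^ x <= B * expR (k * z).
Proof.
move=> x0 k0; have x1 : 0 < x + 1 by lra.
pose l := k / (x + 1); have l0 : 0 < l by rewrite divr_gt0.
exists (expR (- (x * ln l))) => [|z z0]; first exact: expR_gt0.
rewrite /powR gt_eqF// -expRD ler_expR.
have := ln_sublinear (mulr_gt0 l0 z0); rewrite lnM ?posrE//.
have lk : l * (x + 1) = k by rewrite /l divfK ?gt_eqF.
move=> /ltW /(ler_wpM2l x0); have := mulr_gt0 l0 z0; nra.
Qed.

(** Powers grow more slowly than exponentials of any rate: this is applied at [2 * pi * t] for the
    lower bound and at its inverse for the upper one. *)
Lemma heat_factor_bounds (R : realType) (d : nat) (k : R) : 0 < k ->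
  exists2 B : R, 0 < B & forall t : R, 0 < t ->
    B^-1 * expR (- (k * t)) <= (2 * pi * t) `^ (- (d%:R / 2)) <= B * expR (k / t).
Proof.
move=> k0; have p1 : 1 <= 2 * pi :> R by have := @pi_ge2 R; lra.
have d0 : 0 <= d%:R / 2 :> R by rewrite divr_ge0.
have k'0 : 0 < k / (2 * pi) by rewrite divr_gt0//; lra.
have [B1 B10 HB1] := powR_le_expR d0 k0.
have [B2 B20 HB2] := powR_le_expR d0 k'0.
exists (B1 + B2) => [|t t0]; first lra.
have pt : 0 < 2 * pi * t by nra.
apply/andP; split.
  rewrite powRN expRN -invfM lef_pV2 ?posrE ?mulr_gt0 ?expR_gt0 ?powR_gt0//; last lra.
  apply: (le_trans (HB2 _ pt)); rewrite mulrA divfK; last by rewrite gt_eqF//; lra.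
  by rewrite ler_wpM2r ?expR_ge0//; lra.
have -> : (2 * pi * t) `^ (- (d%:R / 2)) = ((2 * pi * t)^-1) `^ (d%:R / 2).
  by rewrite -(powR_inv1 (ltW pt)) -powRrM mulN1r.
apply: (le_trans (HB1 _ _)); first by rewrite invr_gt0.
apply: ler_pM; rewrite ?expR_ge0 ?(ltW B10)//; first lra.
by rewrite ler_expR ler_wpM2l ?(ltW k0)// lef_pV2 ?posrE//; nra.
Qed.

(** The difference is [(b * (l - t) - q / 2) / t]. Its numerator is at most [3 / 2 * K * eta * l],
    because [1 <= eta * l], and [t >= l / 2]. *)
Lemma phase_near (R : realType) (eta K l t b q : R) :
  0 < eta <= 2^-1 -> 1 <= eta * l -> `|t - l| <= eta * l ->
  `|b| <= K -> 0 <= q <= K ->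
  `|(l * b - q / 2) / t - b| <= 3 * eta * K.
Proof.
move=> /andP[e0 e2] el tl bK /andP[q0 qK].
have l0 : 0 < l by nra.
have t2 : l / 2 <= t by move: tl; rewrite ler_norml => /andP[]; nra.
have t0 : 0 < t by lra.
have -> : (l * b - q / 2) / t - b = (b * (l - t) - q / 2) / t by field; rewrite gt_eqF.
rewrite normrM normfV (ger0_norm (ltW t0)) ler_pdivrMr//.
apply: (le_trans (ler_normB _ _)); rewrite normrM distrC (@ger0_norm _ (q / 2)); last lra.
have K0 : 0 <= K by exact: le_trans bK.
have : `|b| * `|t - l| <= K * (eta * l) by apply: ler_pM.
have : K <= K * (eta * l) by rewrite ler_peMr.
have : K * (eta * l) <= K * (eta * (2 * t)).
  by rewrite !ler_wpM2l ?(ltW e0)//; lra.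
by lra.
Qed.

(** From [(t - 2 l)^2 >= 0] follows [t^2 + l^2 <= 2 (t - l)^2 + 3 l^2], and here
    [l^2 <= (t - l)^2 / eta^2]. *)
Lemma sqrB_far (R : realType) (eta l t : R) : 0 < eta <= 2^-1 -> 0 < l ->
  eta * l <= `|t - l| -> eta ^+ 2 / 4 * (t ^+ 2 + l ^+ 2) <= (t - l) ^+ 2.
Proof.
move=> /andP[e0 e2] l0 h.
have h2 : (eta * l) ^+ 2 <= (t - l) ^+ 2.
  rewrite -(real_normK (num_real (t - l))) lerXn2r ?nnegrE//.
  by apply: mulr_ge0; exact: ltW.
have := sqr_ge0 (t - 2 * l); have : eta ^+ 2 <= 4^-1 by nra.
set X := (t - l) ^+ 2 in h2 *.
have : t ^+ 2 + l ^+ 2 + (t - 2 * l) ^+ 2 = 2 * X + 3 * l ^+ 2 by rewrite /X; ring.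
have : 0 <= X by exact: sqr_ge0.
rewrite exprMn in h2; set E := eta ^+ 2 in h2 *.
have : 0 <= E by exact: sqr_ge0.
move: ((t - 2 * l) ^+ 2) => Y; move: (t ^+ 2 + l^+2) => Z; nra.
Qed.

(** * Pointwise estimates of the heat weight *)

Section heat_weight.
Context {R : realType}.
Variables (r : R) (d : nat).
Hypothesis r0 : 0 < r.

(* The integrand of [green r x y], with D = |x - y|^2. *)
Definition heat_weight (D t : R) : R :=
  expR (- (r * t)) * (2 * pi * t) `^ (- (d%:R / 2)) * expR (- (D / (2 * t))).

Lemma heat_weight_gt0 D t : 0 < t -> 0 < heat_weight D t.
Proof.
move=> t0; rewrite /heat_weight !mulr_gt0 ?expR_gt0// powR_gt0//.
by rewrite !mulr_gt0// pi_gt0.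
Qed.

(** With [b] for [a.y] and [q] for [|y|^2], the argument on the left is [|l a - y|^2]; all
    dependence on [y] moves into the last factor. *)
Lemma heat_weightD (l b q t : R) : 0 < t ->
  heat_weight (2 * r * l ^+ 2 - 2 * l * b + q) t =
  heat_weight (2 * r * l ^+ 2) t * expR ((l * b - q / 2) / t).
Proof.
move=> t0; rewrite /heat_weight -[RHS]mulrA -expRD; congr (_ * expR _).
by field; rewrite gt_eqF.
Qed.

Lemma measurable_heat_weight D : measurable_fun (`]0, +oo[%classic : set R) (heat_weight D).
Proof.
apply: (eq_measurable_fun (fun t => expR ((- r) * t) *
    (2 * pi * t) `^ (- (d%:R / 2)) * expR ((- (D / 2)) * t `^ (- 1)))).
  move=> t; rewrite inE /= in_itv/= andbT => t0.
  rewrite /heat_weight powR_inv1 ?ltW// !mulNr.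
  by congr (_ * expR (- _)); rewrite invfM mulrA.
apply: measurable_funTS; apply: measurable_funM; first apply: measurable_funM.
- by apply: measurableT_comp => //; exact: measurable_funM.
- by apply: (measurableT_comp (measurable_powR _)); exact: measurable_funM.
- by apply: measurableT_comp => //; exact: measurable_funM.
Qed.

Lemma heat_weight_near (eta K l t b q : R) :
  0 < eta <= 2^-1 -> 1 <= eta * l -> `|t - l| <= eta * l ->
  `|b| <= K -> 0 <= q <= K -> 3 * eta * K <= 2^-1 ->
  `|expR ((l * b - q / 2) / t) - expR b| <= 6 * eta * K * expR K.
Proof.
move=> e el tl bK qK eK.
have h := phase_near e el tl bK qK.
have := @normr_expRB_le _ b _ (le_trans h eK); rewrite (addrC b) subrK => /le_trans; apply.
apply: ler_pM; rewrite ?expR_ge0 ?mulr_ge0//; first lra.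
by rewrite ler_expR; apply: le_trans bK; exact: ler_norm.
Qed.

(* Away from t = l, (t - l)^2 / t dominates a multiple of t + l^2 / t; part of it
   absorbs t^(-d/2) and the exponential for large l, the rest gives the decay. *)
Lemma heat_weight_far (eta K : R) : 0 <= K -> 0 < eta <= 2^-1 ->
  exists B c L, [/\ 0 < B, 0 < c & forall l t b q : R, L <= l -> 0 < t ->
    `|b| <= K -> 0 <= q -> eta * l <= `|t - l| ->
    heat_weight (2 * r * l ^+ 2) t * `|expR ((l * b - q / 2) / t) - expR b|
    <= B * expR (- (2 * r * l) - c * l) * expR (- c * t)].
Proof.
move=> K0 e; have [B B0 HB] := @heat_factor_bounds R d _ ltr01.
(* By [sqrB_far], [r (t - l)^2 >= k (t^2 + l^2)] away from [l]. *)
have [k kE] : exists k, k = r * (eta ^+ 2 / 4) by eexists.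
have k0 : 0 < k.
  rewrite kE; by move: e => /andP[e0 _]; rewrite mulr_gt0// divr_gt0// exprn_gt0.
(* The threshold gives [l >= 1] and [k l >= 2 (K + 1)], hence [1 + K l <= k l^2 / 2]: this pays for
   the power of [t] and for the phase. *)
exists (2 * B * expR K), (k / 4), (1 + 2 * (K + 1) / k).
split; [by rewrite !mulr_gt0// expR_gt0|lra|move=> l t b q Ll t0 bK q0 tl].
have l1 : 1 <= l by apply: le_trans Ll; rewrite lerDl divr_ge0//; lra.
have lk : 2 * (K + 1) <= k * l.
  by rewrite (mulrC k) -ler_pdivrMr//; apply: le_trans Ll; rewrite lerDr.
have l0 : 0 < l by lra.
have sq := sqrB_far e l0 tl.
have b1 : b <= K by apply: le_trans bK; exact: ler_norm.
have lt0 : 0 <= l / t by rewrite divr_ge0 ?(ltW l0) ?(ltW t0).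
have H1 : `|expR ((l * b - q / 2) / t) - expR b| <= 2 * expR (K * l / t + K).
  apply: (le_trans (ler_normB _ _)); rewrite !ger0_norm ?expR_ge0// [leRHS]mulr_natl [leRHS]mulr2n.
  apply: lerD; rewrite ler_expR.
    apply: (@le_trans _ _ (K * l / t)); last by rewrite lerDl.
    rewrite ler_wpM2r ?invr_ge0 ?(ltW t0)//.
    by have := ler_wpM2l (ltW l0) b1; lra.
  by rewrite (le_trans b1)// lerDr -mulrA mulr_ge0.
have /andP[_ H2] := HB _ t0.
apply: (@le_trans _ _ (expR (- (r * t)) * (B * expR (1 / t)) *
    expR (- (2 * r * l ^+ 2 / (2 * t))) * (2 * expR (K * l / t + K)))).
  rewrite /heat_weight; apply: ler_pM => //.
    by rewrite !mulr_ge0 ?expR_ge0 ?powR_ge0.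
  by rewrite ler_wpM2r ?expR_ge0// ler_wpM2l ?expR_ge0.
set E := (X in X <= _).
have -> : E = 2 * B * (expR (- (r * t)) * expR (1 / t) *
    expR (- (2 * r * l ^+ 2 / (2 * t))) * expR (K * l / t + K)) by rewrite /E; ring.
rewrite -!mulrA -!expRD; do 2 (apply: ler_wpM2l; first lra).
rewrite ler_expR -subr_ge0.
set F := (X in 0 <= X).
have -> : F = (r * (t - l) ^+ 2 - (1 + K * l) - k / 4 * (l + t) * t) / t.
  by rewrite /F; field; rewrite gt_eqF.
apply: divr_ge0; last exact: ltW.
have : k * (t ^+ 2 + l ^+ 2) <= r * (t - l) ^+ 2 by rewrite kE -mulrA ler_wpM2l ?(ltW r0).
have : 1 + K * l <= k / 2 * l ^+ 2 by nra.
have : 0 <= k * ((t - l) ^+ 2) by rewrite mulr_ge0 ?sqr_ge0 ?(ltW k0).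
have : 0 <= k * (t ^+ 2) by rewrite mulr_ge0 ?sqr_ge0 ?(ltW k0).
have : 0 <= k * (l ^+ 2) by rewrite mulr_ge0 ?sqr_ge0 ?(ltW k0).
lra.
Qed.

Lemma heat_weight_dist (eps K : R) : 0 < eps -> 0 <= K ->
  exists B c L, [/\ 0 < B, 0 < c & forall l t b q : R, L <= l -> 0 < t ->
    `|b| <= K -> 0 <= q <= K ->
    heat_weight (2 * r * l ^+ 2) t * `|expR ((l * b - q / 2) / t) - expR b|
    <= eps * heat_weight (2 * r * l ^+ 2) t
       + B * expR (- (2 * r * l) - c * l) * expR (- c * t)].
Proof.
move=> eps0 K0; pose M := 6 * (K + 1) * expR K.
have eK := expR_gt0 K.
have M0 : 0 < M by rewrite !mulr_gt0//; lra.
(* The first bound keeps [eta] and [3 * eta * K] below one half; the second makes the near error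
   [6 * eta * K * expR K] at most [eps]. *)
pose eta := Num.min (6 * (K + 1))^-1 (eps / M).
have eta0 : 0 < eta by rewrite lt_min invr_gt0 divr_gt0// andbT; lra.
have e1 : eta * (6 * (K + 1)) <= 1.
  by rewrite -ler_pdivlMr ?mul1r ?ge_min ?lexx//; lra.
have e2 : eta * M <= eps by rewrite -ler_pdivlMr// ge_min lexx orbT.
have e : 0 < eta <= 2^-1 by rewrite eta0/=; nra.
have [B [c [L [B0 c0 H]]]] := heat_weight_far K0 e.
(* The bound [eta^-1] provides the condition [1 <= eta * l] of the near estimate. *)
exists B, c, (Num.max L eta^-1); split => // l t b q.
rewrite ge_max => /andP[Ll el] t0 bK qK.
have w0 := heat_weight_gt0 (2 * r * l ^+ 2) t0.
have [tl|tl] := leP (`|t - l|) (eta * l); last first.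
  rewrite -[leLHS]add0r lerD ?H//; last exact: ltW.
  - by rewrite mulr_ge0 ?ltW.
  - by case/andP: qK.
rewrite -[leLHS]addr0 lerD//; last by rewrite !mulr_ge0 ?expR_ge0 ?(ltW B0).
rewrite mulrC ler_wpM2r ?(ltW w0)//.
apply: le_trans (@heat_weight_near eta K l t b q e _ tl bK qK _) _.
- by rewrite -ler_pdivrMl ?mulr1.
- by nra.
- apply: le_trans e2; rewrite /M; have := mulr_gt0 eta0 eK; nra.
Qed.

(** One has [r t + r l^2 / t = 2 r l + r (t - l)^2 / t], whose last term is at most [r] on
    [[l, l + 1]]; the power of [t] costs only [exp(-c t)], up to a constant. *)
Lemma heat_weight_lower (c : R) : 0 < c ->
  exists2 B, 0 < B & forall l t : R, 1 <= l -> l <= t <= l + 1 ->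
    B * expR (- (2 * r * l) - c * l) <= heat_weight (2 * r * l ^+ 2) t.
Proof.
move=> c0; have [B B0 HB] := @heat_factor_bounds R d _ c0.
exists (B^-1 * expR (- (r + c))) => [|l t l1 /andP[lt tl]].
  by rewrite mulr_gt0 ?invr_gt0 ?expR_gt0.
have t0 : 0 < t by lra.
have /andP[H _] := HB _ t0.
apply: (@le_trans _ _ (expR (- (r * t)) * (B^-1 * expR (- (c * t))) *
    expR (- (2 * r * l ^+ 2 / (2 * t))))); last first.
  by rewrite /heat_weight ler_wpM2r ?expR_ge0// ler_wpM2l ?expR_ge0.
set E := (X in _ <= X).
have -> : E = B^-1 * (expR (- (r * t)) * expR (- (c * t)) *
    expR (- (2 * r * l ^+ 2 / (2 * t)))) by rewrite /E; ring.
rewrite -!mulrA -!expRD ler_wpM2l ?invr_ge0 ?(ltW B0)// ler_expR -subr_ge0.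
set F := (X in 0 <= X).
have -> : F = (c * (l + 1 - t) * t + r * (t - (t - l) ^+ 2)) / t.
  by rewrite /F; field; rewrite gt_eqF.
apply: divr_ge0; last exact: ltW.
apply: addr_ge0; first by rewrite !mulr_ge0 ?(ltW c0) ?(ltW t0)//; lra.
rewrite mulr_ge0 ?(ltW r0)//; nra.
Qed.

End heat_weight.

Lemma integrable_expRN (R : realType) (c : R) : 0 < c ->
  lebesgue_measure.-integrable (`]0, +oo[%classic : set R)
    (EFin \o (fun t => expR (- c * t))).
Proof.
move=> c0.
have mI : measurable (`]0, +oo[%classic : set (measurableTypeR R)) by [].
have ic := integrableS measurableT mI (@subsetT _ _) (integrable_exponential_pdf c0).
apply: (eq_integrable mI _ _ _ (integrableZl mI c^-1 ic)) => t.
rewrite inE/= in_itv/= andbT => t0.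
by rewrite -EFinM exponential_pdfE ?(ltW t0)// mulrA mulVf ?mul1r ?gt_eqF.
Qed.

(** * Integrals of the heat weight and their asymptotics *)

Section heat_integral.
Context {R : realType}.
Variables (r : R) (d : nat).
Hypothesis r0 : 0 < r.

Let I : set (measurableTypeR R) := `]0, +oo[%classic.
Let mI : measurable I. Proof. exact: measurable_itv. Qed.
Local Notation mu := (@lebesgue_measure R).
Let w (l : R) := heat_weight r d (2 * r * l ^+ 2).

(** Near 0 the power of [t] costs [exp(r / t)], which [exp(- r l^2 / t)] absorbs because [l >= 1];
    the decay [exp(- r t)] remains. *)
Lemma integrable_heat_weight (l : R) : 1 <= l -> mu.-integrable I (EFin \o w l).
Proof.
move=> l1; have [B B0 HB] := @heat_factor_bounds R d _ r0.
apply: (le_integrable mI _ _ (integrableZl mI B (integrable_expRN r0))).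
- by apply/measurable_EFinP; exact: measurable_heat_weight.
- move=> t; rewrite /I /= in_itv/= andbT => t0.
  have /andP[_ H] := HB _ t0.
  rewrite lee_fin !ger0_norm ?(ltW (heat_weight_gt0 _ _ _ t0))//; last first.
    by rewrite mulr_ge0 ?expR_ge0 ?(ltW B0).
  apply: (@le_trans _ _ (expR (- (r * t)) * (B * expR (r / t)) *
      expR (- (2 * r * l ^+ 2 / (2 * t))))).
    by rewrite ler_wpM2r ?expR_ge0// ler_wpM2l ?expR_ge0.
  set E := (X in X <= _).
  have -> : E = B * (expR (- (r * t)) * expR (r / t) *
      expR (- (2 * r * l ^+ 2 / (2 * t)))) by rewrite /E; ring.
  rewrite ler_wpM2l ?(ltW B0)// -!expRD ler_expR -subr_ge0.
  set F := (X in 0 <= X).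
  have -> : F = (r * (l ^+ 2 - 1)) / t by rewrite /F; field; rewrite gt_eqF.
  by rewrite divr_ge0 ?(ltW t0)// mulr_ge0 ?(ltW r0)//; nra.
Qed.

Lemma Rintegral_heat_weight_lower (c : R) : 0 < c ->
  exists2 B, 0 < B & forall l : R, 1 <= l ->
    B * expR (- (2 * r * l) - c * l) <= \int[mu]_(t in I) w l t.
Proof.
move=> c0; have [B B0 HB] := heat_weight_lower d r0 c0.
exists B => // l l1.
have iw := integrable_heat_weight l1.
(* On an interval of length 1 the pointwise lower bound passes unchanged to the integral. *)
set M := B * _; pose J : set (measurableTypeR R) := `[l, l + 1]%classic.
have mJ : measurable J by exact: measurable_itv.
have JI : J `<=` I by move=> t; rewrite /I /J /= !in_itv/= andbT => /andP[lt _]; lra.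
rewrite -lee_fin /Rintegral fineK; last exact: integrable_fin_num.
apply: (@le_trans _ _ (\int[mu]_(t in J) (w l t)%:E)%E); last first.
  apply: ge0_subset_integral => //.
  - by apply/measurable_EFinP; exact: measurable_heat_weight.
  - move=> t; rewrite /I /= in_itv/= andbT => t0.
    by rewrite lee_fin ltW// heat_weight_gt0.
apply: (@le_trans _ _ (\int[mu]_(t in J) (cst M%:E) t)%E).
  have J1 : mu J = 1%E.
    apply: (etrans (lebesgue_measure_itv `[l, l + 1])).
    by rewrite /= lte_fin ltrDl ltr01 -EFinB addrAC subrr add0r.
  by rewrite integral_cst// [X in (_ * X)%E]J1 mule1.
apply: ge0_le_integral => //.
- by move=> t _; rewrite lee_fin mulr_ge0 ?expR_ge0 ?(ltW B0).
- apply/measurable_EFinP.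
  exact: measurable_funS JI (measurable_heat_weight _ _ _).
- by move=> t; rewrite /J /= in_itv/= lee_fin => lt; exact: HB.
Qed.

(** [W] is the total mass of the weight, that is [G_r(l a, 0)]. The far error is exponentially
    smaller than [W] as [l] grows, and [W] is fixed before [b] and [q], which gives uniformity in
    [y]. *)
Lemma heat_integral_asymptotic (eps K : R) : 0 < eps -> 0 <= K ->
  exists L, forall l : R, L <= l -> exists2 W, 0 < W &
    forall b q : R, `|b| <= K -> 0 <= q <= K -> exists2 N,
      (\int[mu]_(t in I) (heat_weight r d (2 * r * l ^+ 2 - 2 * l * b + q) t)%:E
         = N%:E)%E &
      `|N - expR b * W| <= eps * W.
Proof.
move=> eps0 K0; have e20 : 0 < eps / 2 by lra.
have [B [c [L [B0 c0 H]]]] := heat_weight_dist d r0 e20 K0.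
(* The lower bound on [W] uses half the rate of the far error, which leaves a factor [exp(c l / 2)]
   to spare. *)
have c20 : 0 < c / 2 by lra.
have [B' B'0 H'] := Rintegral_heat_weight_lower c20.
set E := \int[mu]_(t in I) expR (- c * t).
have E0 : 0 <= E by apply: Rintegral_ge0 => t _; exact: expR_ge0.
(* The last bound gives [B * E <= eps / 2 * B' * (c / 2 * l)], and [c / 2 * l] is less than the
   spare exponential. *)
exists (Num.max (Num.max L 1) (B * E / (eps / 2 * B' * (c / 2)))) => l.
rewrite !ge_max => /andP[/andP[Ll l1] lE].
have iw := integrable_heat_weight l1.
have iE := integrable_expRN c0.
set W := \int[mu]_(t in I) w l t.
have WB : B' * expR (- (2 * r * l) - c / 2 * l) <= W := H' _ l1.
have W0 : 0 < W by apply: lt_le_trans WB; rewrite mulr_gt0 ?expR_gt0.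
exists W => // b q bK qK.
set A := B * expR (- (2 * r * l) - c * l) in H *.
have AE : A * E <= eps / 2 * W.
  apply: (@le_trans _ _ (eps / 2 * (B' * expR (- (2 * r * l) - c / 2 * l)))); last first.
    by rewrite ler_wpM2l ?(ltW e20).
  have -> : - (2 * r * l) - c / 2 * l = (- (2 * r * l) - c * l) + c / 2 * l by field.
  rewrite /A [in leRHS]expRD; set X := expR (_ - c * l).
  have X0 : 0 < X := expR_gt0 _.
  rewrite mulrAC [leRHS](_ : _ = (eps / 2 * B' * expR (c / 2 * l)) * X); last by ring.
  rewrite ler_wpM2r ?(ltW X0)//.
  move: lE; rewrite ler_pdivrMr ?mulr_gt0// => /le_trans; apply.
  have := expR_ge1Dx (c / 2 * l); have : 0 < eps / 2 * B' by rewrite mulr_gt0.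
  nra.
pose f := heat_weight r d (2 * r * l ^+ 2 - 2 * l * b + q).
have fd t : I t -> `|f t - expR b * w l t| <= eps / 2 * w l t + A * expR (- c * t).
  rewrite /I /= in_itv/= andbT => t0.
  have w0 := heat_weight_gt0 r d (2 * r * l ^+ 2) t0.
  rewrite /f heat_weightD// (mulrC (expR b)) -mulrBr normrM (ger0_norm (ltW w0)).
  exact: H.
have i1 k1 k2 : mu.-integrable I (EFin \o (fun t => k1 * w l t + k2 * expR (- c * t))).
  by have := integrableD mI (integrableZl mI k1 iw) (integrableZl mI k2 iE).
have Ri1 k1 k2 : \int[mu]_(t in I) (k1 * w l t + k2 * expR (- c * t)) = k1 * W + k2 * E.
  rewrite RintegralD ?RintegralZl//.
  - exact: (integrableZl mI k1 iw).
  - exact: (integrableZl mI k2 iE).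
(* The two-sided bound by integrable functions yields first the integrability of [f], then the
   estimate of its integral. *)
have fu t : I t -> f t <= (expR b + eps / 2) * w l t + A * expR (- c * t).
  by move=> /fd; rewrite ler_norml => /andP[_]; lra.
have fl t : I t -> (expR b - eps / 2) * w l t + (- A) * expR (- c * t) <= f t.
  by move=> /fd; rewrite ler_norml => /andP[]; lra.
have fi : mu.-integrable I (EFin \o f).
  apply: le_integrable (i1 (expR b + eps / 2) A) => //.
    by apply/measurable_EFinP; exact: measurable_heat_weight.
  move=> t It; have t0 : 0 < t by move: It; rewrite /I /= in_itv/= andbT.
  rewrite lee_fin (ger0_norm (ltW (heat_weight_gt0 _ _ _ t0))).
  by apply: le_trans (fu _ It) _; exact: ler_norm.
exists (\int[mu]_(t in I) f t).
  by rewrite /Rintegral fineK// integrable_fin_num.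
have hu := le_Rintegral mI fi (i1 _ _) fu.
have hl := le_Rintegral mI (i1 _ _) fi fl.
rewrite !Ri1 in hu hl.
by rewrite ler_norml; apply/andP; split; lra.
Qed.

End heat_integral.

(** * Passage to the limit in a sequence of annihilating kernels *)

Lemma kernel_limit_annihilates d (T : measurableType d) (R : realType)
    (mu : {measure set T -> \bar R}) (D : set T) (mD : measurable D)
    (k : nat -> T -> R) (h f : T -> R) (m M : R) : 0 < m ->
    (forall y, D y -> m <= k 0%N y) ->
    (forall n y, D y -> `|k n y| <= M) ->
    (forall y, D y -> k n y @[n --> \oo] --> h y) ->
    (forall n, mu.-integrable D (fun y => (k n y * f y)%:E)) ->
    (forall n, (\int[mu]_(y in D) (k n y * f y)%:E = 0)%E) ->
  mu.-integrable D (fun y => (h y * f y)%:E) /\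
  (\int[mu]_(y in D) (h y * f y)%:E = 0)%E.
Proof.
move=> m0 mk kM kh ik ik0.
(* The majorant: [|f| <= |k 0 f| / m] on [D], while every [k n] and the limit [h] are bounded by
   [M]. *)
pose g y := ((M / m)%:E * `|(k 0%N y * f y)%:E|)%E.
have ig : mu.-integrable D g by apply: integrableZl => //; exact: integrable_abse.
have mkf n : measurable_fun D (fun y => (k n y * f y)%:E).
  by have /integrableP[] := ik n.
have khf y : D y -> (k n y * f y)%:E @[n --> \oo] --> (h y * f y)%:E.
  move=> Dy; apply: cvg_EFin; first by near=> n.
  by apply: cvgMl; exact: kh.
have gb z y : D y -> `|z| <= M -> (`|(z * f y)%:E| <= g y)%E.
  move=> Dy zM; rewrite /g /= -EFinM lee_fin !normrM mulrA ler_wpM2r//.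
  have k0 := mk _ Dy; rewrite (ger0_norm (le_trans (ltW m0) k0)).
  rewrite mulrAC ler_pdivlMr// ler_pM ?(ltW m0)//.
have hM y : D y -> `|h y| <= M.
  move=> Dy; have /cvg_norm kn := kh _ Dy.
  rewrite -(cvg_lim _ kn)//; apply: limr_le; first by apply/cvg_ex; exists `|h y|.
  by apply: nearW => n; exact: kM.
split.
  apply: (le_integrable mD _ _ ig).
    exact: emeasurable_fun_cvg mkf khf.
  move=> y Dy; apply: (le_trans (gb _ _ Dy (hM _ Dy))).
  by rewrite /g /= -!EFinM lee_fin ler_norm.
have := dominated_cvg mD mkf khf (fun y _ => _ : g y \is a fin_num) ig
  (fun n y Dy => gb _ _ Dy (kM n _ Dy)).
under eq_fun do rewrite ik0.
by move=> H; apply/esym; have := cvg_unique _ (cvg_cst 0%E) (H _); exact.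
Unshelve. all: by end_near.
Qed.

(** * Euclidean geometry and the normalised Green kernel *)

Section euclidean_lemmas.
Context {R : realType} {d : nat}.
Implicit Types x y a : 'rV[R]_d.

Lemma sqr_enorm x : enorm x ^+ 2 = dotp x x.
Proof. by rewrite sqr_sqrtr// sumr_ge0// => i _; rewrite -expr2 sqr_ge0. Qed.

Lemma dotpZBZB (l : R) a y : dotp (l *: a - y) (l *: a - y) =
  dotp a a * l ^+ 2 - 2 * l * dotp a y + dotp y y.
Proof.
rewrite /dotp mulr_suml mulr_sumr -sumrB -big_split/=.
by apply: eq_bigr => i _; rewrite !mxE; ring.
Qed.

Lemma dotpZZ (l : R) a : dotp (l *: a) (l *: a) = l ^+ 2 * dotp a a.
Proof.
by rewrite /dotp mulr_sumr; apply: eq_bigr => i _; rewrite !mxE; ring.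
Qed.

Lemma bounded_dotp (C : set 'rV[R]_d) a : bounded_set C ->
  exists2 K : R, 0 <= K & forall y, C y -> `|dotp a y| <= K /\ 0 <= dotp y y <= K.
Proof.
move=> /ex_strict_bound_gt0[M M0 CM].
have yM y i : C y -> `|y ord0 i| <= M.
  move=> /CM/ltW/=; apply: le_trans.
  rewrite [leRHS]mx_normrE.
  exact: (le_bigmax _ (fun ij => `|y ij.1 ij.2|) (ord0, i)).
have S0 : 0 <= \sum_(i < d) `|a ord0 i| * M.
  by apply: sumr_ge0 => i _; rewrite mulr_ge0// ltW.
have S1 : 0 <= \sum_(i < d) M * M.
  by apply: sumr_ge0 => i _; rewrite mulr_ge0// ltW.
exists (\sum_(i < d) `|a ord0 i| * M + \sum_(i < d) M * M); first exact: addr_ge0.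
move=> y Cy; split; last (apply/andP; split).
- apply: (@le_trans _ _ (\sum_(i < d) `|a ord0 i| * M)); last by rewrite lerDl.
  apply: (le_trans (ler_norm_sum _ _ _)); apply: ler_sum => i _.
  by rewrite normrM ler_wpM2l// yM.
- by apply: sumr_ge0 => i _; rewrite -expr2 sqr_ge0.
- apply: (@le_trans _ _ (\sum_(i < d) M * M)); last by rewrite lerDr.
  apply: ler_sum => i _; apply: (le_trans (ler_norm _)).
  by rewrite normrM ler_pM ?yM.
Qed.

(** The pair consists of the pole [l a] and the normalising constant [W], common to all [y] in
    [C]. *)
Lemma green_martin (r eps : R) (C : set 'rV[R]_d) a : 0 < r -> B2 r a ->
  bounded_set C -> 0 < eps ->
  exists xW : 'rV[R]_d * R, [/\ ~ C xW.1, 0 < xW.2 & forall y, C y ->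
    green r xW.1 y \is a fin_num /\
    `|fine (green r xW.1 y) / xW.2 - expR (dotp a y)| <= eps].
Proof.
move=> r0; rewrite /B2 /= sqr_enorm => ar Cb eps0.
have [K K0 CK] := bounded_dotp a Cb.
have [L HL] := heat_integral_asymptotic d r0 eps0 K0.
(* The second bound forces [|l a|^2 = 2 r l^2 > K], whereas [|y|^2 <= K] on [C]; hence the pole lies
   outside [C]. *)
pose l := Num.max L (1 + K / (2 * r)).
have Ll : L <= l by rewrite le_max lexx.
have lK : 1 + K / (2 * r) <= l by rewrite le_max lexx orbT.
have [W W0 HW] := HL l Ll.
exists (l *: a, W); split => //=.
  move=> /CK[_ /andP[_]]; rewrite dotpZZ ar; apply/negP; rewrite -ltNge.
  rewrite -ltr_pdivrMr; last lra.
  have : 0 <= K / (2 * r) by rewrite divr_ge0//; lra.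
  nra.
move=> y /CK[aK yK]; have [N NE NW] := HW _ _ aK yK.
have -> : green r (l *: a) y = N%:E by rewrite /green sqr_enorm dotpZBZB ar.
split => //=.
have -> : N / W - expR (dotp a y) = (N - expR (dotp a y) * W) / W.
  by field; rewrite gt_eqF.
by rewrite normrM normfV (ger0_norm (ltW W0)) ler_pdivrMr.
Qed.

End euclidean_lemmas.

(** * From the Green kernel equation to the Martin kernel equation *)

Theorem theorem3p5 (R : realType) (d : nat) (r : R) (hr : 0 < r)
    (g : 'rV[R]_d -> R) (hg : continuous g) (hg0 : forall x, 0 <= g x)
    (C : set 'rV[R]_d) (hCb : bounded_set C) (hCm : lebesgue_measurable C)
    (hgC : exists U : set 'rV[R]_d, [/\ open U, C `<=` U & C2_on U g])
    (hgreen : forall x, (~` C) x ->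
      (@lebesgue_rV R d).-integrable C
        (fun y => (green r x y * (resolvent_op r g y)%:E)%E) /\
      (\int[@lebesgue_rV R d]_(y in C)
        (green r x y * (resolvent_op r g y)%:E) = 0)%E) :
  forall a : 'rV[R]_d, B2 r a ->
    (@lebesgue_rV R d).-integrable C
      (fun y => (expR (dotp a y) * resolvent_op r g y)%:E) /\
    (\int[@lebesgue_rV R d]_(y in C)
      (expR (dotp a y) * resolvent_op r g y)%:E = 0)%E.
Proof.
move=> a ar; have [K K0 CK] := bounded_dotp a hCb.
(* Besides tending to 0, [eps n] is at most half the minimum [expR (- K)] allowed for
   [expR (dotp a y)] on [C], so already the kernel of index 0 is bounded away from 0. *)
pose eps (n : nat) : R := expR (- K) / 2 * n.+1%:R^-1.
have eps0 n : 0 < eps n by rewrite !mulr_gt0 ?expR_gt0 ?invr_gt0.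
have /choice[xW HxW] n := green_martin hr ar hCb (eps0 n).
pose k n y := fine (green r (xW n).1 y) / (xW n).2.
have kE n y : C y -> `|k n y - expR (dotp a y)| <= eps n.
  by move=> Cy; have [_ _ /(_ _ Cy)[]] := HxW n.
have expK y : C y -> expR (- K) <= expR (dotp a y) <= expR K.
  by move=> /CK[]; rewrite !ler_expR ler_norml.
have epsK n : eps n <= expR (- K) / 2.
  by rewrite ler_piMr ?mulr_ge0 ?expR_ge0// invf_le1 ?ltr0n// ler1n.
have eK := expR_gt0 (- K).
(* The Green kernel is finite on [C] for these poles, so [fine] loses nothing and the normalised
   integrand is a constant multiple of the given one. *)
have kf n y : C y -> ((k n y * resolvent_op r g y)%:E =
    (xW n).2^-1%:E * (green r (xW n).1 y * (resolvent_op r g y)%:E))%E.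
  move=> Cy; have [_ _ /(_ _ Cy)[gfin _]] := HxW n.
  by rewrite -(fineK gfin) /k -!EFinM /=; congr EFin; ring.
apply: (@kernel_limit_annihilates _ _ _ _ _ hCm k _ _ (expR (- K) / 2)
  (expR K + expR (- K))).
- by rewrite divr_gt0.
- move=> y Cy; have := epsK 0%N; have /andP[] := expK _ Cy.
  by have := kE 0%N _ Cy; rewrite ler_norml => /andP[]; lra.
- move=> n y Cy; have := epsK n; have /andP[] := expK _ Cy; have := expR_gt0 K.
  by have := kE n _ Cy; rewrite !ler_norml => /andP[]; lra.
- move=> y Cy; apply/cvgrPdist_le => e e0.
  have ec : eps n @[n --> \oo] --> (0 : R).
    by rewrite -(mulr0 (expR (- K) / 2)); apply: cvgMr; exact: cvg_harmonic.
  near=> n; rewrite distrC; apply: (le_trans (kE _ _ Cy)).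
  rewrite -(ger0_norm (ltW (eps0 n))) -normrN -sub0r.
  by near: n; move/cvgrPdist_le : ec; exact.
- move=> n; have [/hgreen[gi _] _ _] := HxW n.
  apply: (eq_integrable hCm _ _ _ (integrableZl hCm (xW n).2^-1 gi)) => y.
  by rewrite inE => Cy; rewrite kf.
- move=> n; have [/hgreen[gi g0] _ _] := HxW n.
  transitivity ((xW n).2^-1%:E *
      \int[@lebesgue_rV R d]_(y in C)
        (green r (xW n).1 y * (resolvent_op r g y)%:E))%E; last by rewrite g0 mule0.
  rewrite -(integralZl hCm gi); apply: eq_integral => y.
  by rewrite inE => Cy; rewrite kf.
Unshelve. all: by end_near.
Qed.
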